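(* Let $n\ge 7$ be an odd integer not divisible by $3$. For $a\in\mathbb Z_n$ let $B_a$ be the collection of blocks $\{a-i,a+i\}\cup\{a-j,a+j\}$ (computed mod $n$) for $1\le i<j\le\frac{n-1}{2}$, i.e. all unions of two distinct pairs $\{a-i,a+i\}$. Then $(\mathbb Z_n,\bigcup_{a\in\mathbb Z_n}B_a)$ is a $3$-$(n,4,2)$ adesign.
   Context: A $t$-$(v,k,\lambda)$ adesign is an incidence structure with $v$ points and blocks of size $k$ such that every $t$-subset of points lies in exactly $\lambda$ or exactly $\lambda+1$ blocks, both values occurring. *)

(* Defs.v *)
From HB Require Import structures.
From mathcomp Require Import all_boot all_order all_algebra.
Set Implicit Arguments.
Unset Strict Implicit.
Unset Printing Implicit Defensive.

Import GRing.Theory.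
Local Open Scope ring_scope.

(* Blocks form a type of their own, so an incidence structure may have
   repeated blocks. *)
Record incidence_structure := IncidenceStructure {
  point : finType;
  block : finType;
  incident : point -> block -> bool
}.

Definition points_on (D : incidence_structure) (b : block D) : {set point D} :=
  [set x | incident x b].

Definition blocks_through (D : incidence_structure) (S : {set point D}) :
  {set block D} := [set b | S \subset points_on b].

Definition adesign (t v k lambda : nat) (D : incidence_structure) : Prop :=
  [/\ #|point D| = v,
      forall b : block D, #|points_on b| = k,
      forall S : {set point D}, #|S| = t ->
        #|blocks_through S| = lambda \/ #|blocks_through S| = lambda.+1,
      exists2 S : {set point D}, #|S| = t & #|blocks_through S| = lambda
    & exists2 S : {set point D}, #|S| = t & #|blocks_through S| = lambda.+1].

Definition set_system (P : finType) (B : {set {set P}}) : incidence_structure :=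
  @IncidenceStructure P {b : {set P} | b \in B} (fun x b => x \in val b).

(* 'Z_n is the ring of integers mod n only for n > 1. *)
Definition sym_pair (n : nat) (a : 'Z_n) (i : nat) : {set 'Z_n} :=
  [set a - i%:R; a + i%:R].

Definition sym_blocks (n : nat) (a : 'Z_n) : {set {set 'Z_n}} :=
  [set sym_pair a ij.1 :|: sym_pair a ij.2
     | ij : 'I_(n.-1./2.+1) * 'I_(n.-1./2.+1) & (1 <= ij.1 < ij.2)%N].

(* Main.v *)
(** In a finite abelian group without 2- or 3-torsion, call a 4-set balanced
    if it splits into two pairs of equal sum; in [Z_n] these are the blocks.
    A 4-set with sum [s] is balanced iff it contains two distinct points [w], [r]
    with [2(w + r) = s], so a 3-set [S] with sum [s] is completed to a balanced
    set exactly by the points [w = s - 2r] with [r] in [S] that lie outside [S].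
    Such a [w] lies in [S] only if [w = r], that is [3r = s], which happens for at
    most one [r].  Hence [S] lies in 2 or 3 blocks, and it lies in 2 of them iff
    one of its points is the midpoint of the other two, as in [{0, 1, 2}] but not
    in [{0, 1, 3}]. *)
Require Import Defs.
From mathcomp Require Import all_boot all_order all_algebra.
From mathcomp Require Import zify.

Set Implicit Arguments.
Unset Strict Implicit.
Unset Printing Implicit Defensive.

Import GRing.Theory.
Local Open Scope ring_scope.

(** * Balanced sets in a finite abelian group, and their number through a triple *)

(** Comparing twice one pair sum with the total expresses equality of the two pair sums without
    naming the second pair. *)
Definition balanced (V : finZmodType) (B : {set V}) : bool :=
  (#|B| == 4%N) && [exists w in B, exists r in B,
    (w != r) && ((w + r) *+ 2 == \sum_(x in B) x)].

Lemma balancedP (V : finZmodType) (B : {set V}) :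
  reflect (#|B| = 4%N /\ exists w r, [/\ w \in B, r \in B, w != r
                            & (w + r) *+ 2 = \sum_(x in B) x])
          (balanced B).
Proof.
apply: (iffP andP) => -[] => [/eqP cB|cB].
  move=> /exists_inP[w wB /exists_inP[r rB /andP[wr /eqP e]]].
  by split=> //; exists w, r.
move=> [w [r [wB rB wr e]]]; split; first exact/eqP.
apply/exists_inP; exists w => //; apply/exists_inP; exists r => //.
by rewrite wr e eqxx.
Qed.

Lemma sum_set3 (V : finZmodType) (S : {set V}) (x y : V) :
  #|S| = 3 -> x \in S -> y \in S -> x != y ->
  exists z, [/\ z \in S, z != x, z != y & \sum_(i in S) i = x + y + z].
Proof.
move=> cS xS yS xy.
have yS' : y \in S :\ x by rewrite !inE eq_sym xy.
have /eqP/cards1P[z Ez] : #|S :\ x :\ y| = 1%N.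
  by move: cS; rewrite (cardsD1 x) xS (cardsD1 y) yS' => -[].
have : z \in S :\ x :\ y by rewrite Ez set11.
rewrite !inE => /and3P[zy zx zS]; exists z; split=> //.
by rewrite (big_setD1 x) //= (big_setD1 y) //= Ez big_set1 addrA.
Qed.

(** The point [w] lies in the given pair or in its complement, which has the same sum. If [r] is its
    partner there, then [2(w + r) = w + s] with [s] the sum of [S]. *)
Lemma partner_in_balanced (V : finZmodType) (S : {set V}) (w : V) :
  #|S| = 3 -> w \notin S -> balanced (w |: S) ->
  exists2 r, r \in S & w = \sum_(x in S) x - r *+ 2.
Proof.
move=> cS wS /balancedP[_ [p [q [pB qB pq]]]].
rewrite big_setU1 //=; set s := \sum_(x in S) x => e.
have partner r : (w + r) *+ 2 = w + s -> w = s - r *+ 2.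
  by rewrite mulrnDl mulr2n -addrA => /addrI <-; rewrite addrK.
move: pB qB pq e; rewrite !inE => /orP[/eqP->|pS] /orP[/eqP->|qS] pq e.
- by rewrite eqxx in pq.
- by exists q => //; exact: partner.
- by exists p => //; apply: partner; rewrite addrC.
(* The given pair avoids [w], so [w] is paired with the third point of [S]. *)
have [r [rS _ _ Es]] := sum_set3 cS pS qS pq.
exists r => //; apply: partner; rewrite -/s in Es.
have epq : p + q = w + r.
  by move: e; rewrite Es mulr2n [RHS]addrCA => /addrI.
by rewrite -epq e.
Qed.

(** Let [s] be the sum of [S]. If [t = s - 2r] were a point of [S] other than [r], the third point
    would be [s - r - t = r], a repetition. So [t = r]. *)
Lemma partner_in_triple (V : finZmodType) (S : {set V}) (r : V) :
  #|S| = 3 -> r \in S ->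
  (\sum_(x in S) x - r *+ 2 \in S) = (r *+ 3 == \sum_(x in S) x).
Proof.
move=> cS rS; apply/idP/eqP => [tS | <-]; last by rewrite mulrS addrK.
have [e | rt] := eqVneq r (\sum_(x in S) x - r *+ 2).
  by rewrite mulrS [X in X + _]e subrK.
have [z [_ zr _ /eqP]] := sum_set3 cS rS tS rt.
rewrite [r + _]addrC mulr2n opprD addrA subrK addrAC eq_sym subr_eq.
by rewrite (inj_eq (addrI _)) (negPf zr).
Qed.

Lemma card_balanced_through (V : finZmodType) (S : {set V}) :
  injective (fun x : V => x *+ 2) -> #|S| = 3 ->
  #|[set B : {set V} | balanced B & S \subset B]|
    = #|[set r in S | r *+ 3 != \sum_(x in S) x]|.
Proof.
move=> inj2 cS; set s := \sum_(x in S) x.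
have notin r : r \in S -> r *+ 3 != s -> s - r *+ 2 \notin S.
  by move=> rS; rewrite partner_in_triple.
pose complete r := (s - r *+ 2) |: S.
(* The added point is the only one of [complete r] outside [S]; it determines [2r], hence [r]. *)
have inj_complete : {in [set r in S | r *+ 3 != s] &, injective complete}.
  move=> r t; rewrite !inE => /andP[rS r3] /andP[tS t3] /setP/(_ (s - r *+ 2)).
  rewrite /complete setU11 !inE (negPf (notin _ rS r3)) orbF.
  by move/esym/eqP/addrI/oppr_inj/inj2.
rewrite -(card_in_imset inj_complete); apply/eq_card => B; rewrite inE.
apply/andP/imsetP => [[balB SB] | [r]].
  have cB : #|B| = 4%N by case/balancedP: balB.
  have /eqP/cards1P[w Ew] : #|B :\: S| = 1%N by rewrite cardsDS // cB cS.
  have EB : B = w |: S by rewrite -Ew setUC -{1}(setIidPr SB) setID.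
  have wS : w \notin S by have := set11 w; rewrite -Ew inE => /andP[].
  rewrite EB in balB; have [r rS Er] := partner_in_balanced cS wS balB.
  exists r; last by rewrite EB Er.
  by rewrite inE rS -partner_in_triple // -Er.
rewrite inE => /andP[rS r3] ->; split; last exact: subsetUr.
have wS := notin _ rS r3; apply/balancedP; split; first by rewrite cardsU1 wS cS.
(* The added point [w] is paired with [r]: from [w + 2r = s] follows [2(w + r) = w + s]. *)
exists (s - r *+ 2), r; rewrite setU11 setU1r //; split=> //.
  by apply: contraNneq wS => ->.
by rewrite big_setU1 //= mulrnDl [_ *+ 2]mulr2n -addrA subrK.
Qed.

(** Tripling is injective, so at most one [r] is exceptional and the boolean, read as 0 or 1, counts
    the exceptions. *)
Lemma card_balanced_through_triple (V : finZmodType) (S : {set V}) :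
  injective (fun x : V => x *+ 2) -> injective (fun x : V => x *+ 3) ->
  #|S| = 3 ->
  #|[set B : {set V} | balanced B & S \subset B]|
    = (3 - [exists r in S, r *+ 3 == \sum_(x in S) x]%R)%N.
Proof.
move=> inj2 inj3 cS; rewrite card_balanced_through //; set s := \sum_(x in S) x.
pose M := [set r in S | r *+ 3 == s].
have -> : [set r in S | r *+ 3 != s] = S :\: M.
  by apply/setP => r; rewrite !inE; case: (r \in S) => /=; rewrite ?andbT ?andbF.
rewrite cardsDS ?cS; last by apply/subsetP => r; rewrite inE => /andP[].
congr (3 - _)%N; case: exists_inP => [[r rS r3] | no].
  suff -> : M = [set r] by rewrite cards1.
  apply/setP => t; rewrite !inE -(eqP r3) (inj_eq inj3).
  by case: eqP => [->|]; rewrite ?rS ?andbF.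
apply/eqP; rewrite cards_eq0; apply/eqP/setP => r; rewrite !inE.
by apply/negP => /andP[rS r3]; case: no; exists r.
Qed.

(** * From blocks of a set system to plain subsets *)

Lemma points_on_set_system (P : finType) (B : {set {set P}})
    (b : block (set_system B)) : points_on b = val b.
Proof. by apply/setP => x; rewrite inE. Qed.

Lemma card_blocks_through_set_system (P : finType) (B : {set {set P}})
    (S : {set P}) :
  #|@blocks_through (set_system B) S| = #|[set X in B | S \subset X]|.
Proof.
rewrite -(card_imset _ val_inj); apply/eq_card => X; rewrite inE.
apply/imsetP/andP => [[b] | [XB SX]].
  by rewrite inE points_on_set_system => Sb ->; rewrite (valP b).
by exists (Sub X XB); rewrite ?inE ?points_on_set_system.
Qed.

(** Two pairs of equal sum share a midpoint, half that sum; conversely a pair symmetric about [a]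
    sums to [2a]. The four inequalities make the offsets [u], [-u], [v], [-v] distinct. *)
Lemma balanced_midpointP (V : finZmodType) (B : {set V}) :
  injective (fun x : V => x *+ 2) ->
  reflect (exists a u v, [/\ [/\ u != 0, v != 0, u != v & u + v != 0]
             & B = [set a - u; a + u] :|: [set a - v; a + v]])
          (balanced B).
Proof.
move=> inj2; have neq_opp (x : V) : x != 0 -> x != - x.
  by move=> x0; rewrite -subr_eq0 opprK -mulr2n -(mul0rn V 2) (inj_eq inj2).
apply: (iffP (balancedP B)) => [[cB [w [r [wB rB wr e]]]] | ].
  have rB' : r \in B :\ w by rewrite !inE eq_sym wr.
  have /eqP/cards2P[s [t [st Est]]] : #|B :\ w :\ r| = 2%N.
    by move: cB; rewrite (cardsD1 w) wB (cardsD1 r) rB' => -[].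
  have neq x : x \in [set s; t] -> [/\ x != w & x != r].
    by rewrite -Est !inE => /and3P[].
  have [sw sr] := neq s (set21 s t); have [tw tr] := neq t (set22 s t).
  have est : w + r = s + t.
    move: e; rewrite (big_setD1 w) //= (big_setD1 r) //= Est.
    by rewrite big_setU1 ?inE //= big_set1 addrA mulr2n => /addrI.
  (* Halving is possible because an injective self-map of a finite type is bijective. *)
  have [a Ea] : exists a, a *+ 2 = w + r.
    by have [h _ hK] := injF_bij inj2; exists (h (w + r)); rewrite hK.
  have aw : a - (r - a) = w by rewrite opprB addrA -mulr2n Ea addrK.
  have as' : a - (t - a) = s by rewrite opprB addrA -mulr2n Ea est addrK.
  have ar : a + (r - a) = r by rewrite addrC subrK.
  have at' : a + (t - a) = t by rewrite addrC subrK.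
  exists a, (r - a), (t - a); rewrite aw as' ar at'; split; last first.
    by rewrite -Est -setUA setD1K // setD1K.
  split; last 1 first.
  - apply: contra_neq tw => /eqP; rewrite addr_eq0 => /eqP e0.
    by rewrite -[LHS]at' -[RHS]aw e0 opprK.
  - by apply: contra_neq wr => e0; rewrite -[LHS]aw -[RHS]ar e0 subr0 addr0.
  - by apply: contra_neq st => e0; rewrite -[LHS]as' -[RHS]at' e0 subr0 addr0.
  - by rewrite (inj_eq (addIr _)) eq_sym.
move=> [a [u [v [[u0 v0 uv uNv] ->]]]].
have disj : [disjoint [set a - u; a + u] & [set a - v; a + v]].
  rewrite disjoints_subset; apply/subsetP => x; rewrite !inE.
  rewrite negb_or => /orP[] /eqP->; rewrite !(inj_eq (addrI a)) ?(inj_eq oppr_inj);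
  by rewrite ?uv ?eqr_oppLR -?addr_eq0 ?uNv // -addr_eq0 opprK uNv.
have card_pair (x : V) : x != 0 -> #|[set a - x; a + x]| = 2%N.
  by move=> x0; rewrite cards2 (inj_eq (addrI a)) eq_sym neq_opp.
have sum_pair (x : V) : x != 0 -> \sum_(y in [set a - x; a + x]) y = a *+ 2.
  move=> x0; rewrite big_setU1 ?big_set1 /= ?inE.
    by rewrite addrACA addNr addr0.
  by rewrite (inj_eq (addrI a)) eq_sym neq_opp.
split; first by rewrite cardsU disjoint_setI0 // cards0 !card_pair.
exists (a - u), (a + u); rewrite !inE !eqxx !orbT; split=> //.
  by rewrite (inj_eq (addrI a)) eq_sym neq_opp.
rewrite (eq_bigl _ _ (fun x => in_setU x _ _)) bigU //= !sum_pair //.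
by rewrite addrACA addNr addr0 !mulr2n.
Qed.

(** * Residues modulo [n] and the symmetric blocks *)

Lemma mulrn_Zp_inj (n k : nat) :
  (1 < n)%N -> coprime n k -> injective (fun x : 'Z_n => x *+ k).
Proof.
move=> n1 cnk x y /=; rewrite -[x *+ k]mulr_natr -[y *+ k]mulr_natr.
by apply: mulIr; rewrite unitZpE.
Qed.

Lemma natr_Zp_eq0 (n k : nat) :
  (1 < n)%N -> (k%:R == 0 :> 'Z_n) = (n %| k)%N.
Proof. by move=> n1; rewrite -val_eqE /= val_Zp_nat. Qed.

Lemma natr_Zp_neq0 (n k : nat) : (0 < k < n)%N -> k%:R != 0 :> 'Z_n.
Proof.
by case/andP=> k0 kn; rewrite natr_Zp_eq0 ?(leq_trans _ kn) // gtnNdvd.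
Qed.

(** For odd [n], one of [u] and [n - u] is at most [(n - 1) / 2], and negating the offset only swaps
    the two points. *)
Lemma sym_pair_offset (n : nat) (u : 'Z_n) :
  (1 < n)%N -> odd n -> u != 0 ->
  exists2 i, (1 <= i <= n.-1./2)%N &
    forall a, [set a - u; a + u] = sym_pair a i.
Proof.
move=> n1 oddn u0.
have m0 : (0 < u)%N by rewrite lt0n -val_eqE in u0 *.
have mn : (u < n)%N by rewrite -[X in (_ < X)%N](Zp_cast n1).
have [le | gt] := leqP u n.-1./2.
  by exists u; [rewrite m0 | rewrite /sym_pair natr_Zp].
exists (n - u)%N; first by lia.
move=> a; rewrite /sym_pair natrB ?(ltnW mn) // natr_Zp pchar_Zp //.
by rewrite sub0r opprK setUC.
Qed.

Lemma sym_blocksE (n : nat) :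
  (1 < n)%N -> odd n ->
  \bigcup_(a : 'Z_n) sym_blocks a = [set B | balanced B].
Proof.
move=> n1 oddn; apply/setP => B; rewrite inE.
have inj2 : injective (fun x : 'Z_n => x *+ 2).
  by apply: mulrn_Zp_inj; rewrite // coprimen2.
apply/bigcupP/(balanced_midpointP B inj2).
  move=> [a _ /imsetP[[[i ilt] [j jlt]]]]; rewrite inE /= => /andP[i1 ij] ->.
  exists a, i%:R, j%:R; split=> //; split.
  - by apply: natr_Zp_neq0; lia.
  - by apply: natr_Zp_neq0; lia.
  - rewrite eq_sym -subr_eq0 -natrB ?(ltnW ij) //; apply: natr_Zp_neq0; lia.
  (* Both indices are at most [(n - 1) / 2], so [0 < i + j < n]. *)
  - rewrite -natrD; apply: natr_Zp_neq0; lia.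
move=> [a [u [v [[u0 v0 uv uNv] ->]]]]; exists a => //.
have [i /andP[i1 im] Ei] := sym_pair_offset n1 oddn u0.
have [j /andP[j1 jm] Ej] := sym_pair_offset n1 oddn v0.
rewrite Ei Ej; have [lt | lt | eq_ij] := ltngtP i j.
- apply/imsetP; exists (Ordinal (im : (i < _.+1)%N), Ordinal (jm : (j < _.+1)%N)) => //.
  by rewrite inE /= i1.
- rewrite setUC; apply/imsetP.
  exists (Ordinal (jm : (j < _.+1)%N), Ordinal (im : (i < _.+1)%N)) => //.
  by rewrite inE /= j1.
(* Equal indices would put [a + u] in the pair of [v], forcing [u = v] or [u = -v]. *)
have := set22 (a - u) (a + u); rewrite Ei eq_ij -Ej !inE !(inj_eq (addrI a)).
by rewrite -addr_eq0 (negPf uNv) (negPf uv).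
Qed.

Lemma card_set01k (n k : nat) :
  (1 < k < n)%N -> #|[set 0; 1; k%:R] : {set 'Z_n}| = 3.
Proof.
case/andP=> k1 kn; have k0 := ltnW k1.
have k_neq1 : k%:R != 1 :> 'Z_n.
  by rewrite -subr_eq0 -(natrB _ k0) natr_Zp_neq0 //; lia.
rewrite -setUA !cardsU1 cards1 !inE negb_or ![0 == _]eq_sym oner_eq0.
by rewrite natr_Zp_neq0 ?k0 // eq_sym k_neq1.
Qed.

Lemma sum_set01k (n k : nat) :
  (1 < k < n)%N -> \sum_(x in [set 0; 1; k%:R] : {set 'Z_n}) x = k.+1%:R.
Proof.
move=> kn; set S := [set 0; 1; _].
have S0 : 0 \in S by rewrite !inE eqxx.
have S1 : 1 \in S by rewrite !inE eqxx orbT.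
have neq01 : 0 != 1 :> 'Z_n by rewrite eq_sym oner_eq0.
have [z [zS z0 z1 ->]] := sum_set3 (card_set01k kn) S0 S1 neq01.
move: zS; rewrite !inE (negPf z0) (negPf z1) => /eqP->.
by rewrite add0r -mulrS.
Qed.

Local Close Scope ring_scope.

Theorem theorem12 (n : nat) (n_ge7 : 7 <= n) (n_odd : odd n)
    (n_not3 : ~~ (3 %| n)) :
  adesign 3 n 4 2 (set_system (\bigcup_(a : 'Z_n) sym_blocks a)).
Proof.
have n1 : 1 < n by lia.
have inj2 : injective (fun x : 'Z_n => x *+ 2)%R.
  by apply: mulrn_Zp_inj; rewrite // coprimen2.
have inj3 : injective (fun x : 'Z_n => x *+ 3)%R.
  by apply: mulrn_Zp_inj; rewrite // coprime_sym prime_coprime.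
rewrite sym_blocksE //; set D := set_system _.
have through (S : {set 'Z_n}) : #|S| = 3 ->
    #|@blocks_through D S| = 3 - [exists r in S, r *+ 3 == \sum_(x in S) x]%R.
  move=> cS; rewrite card_blocks_through_set_system.
  rewrite -card_balanced_through_triple //.
  by apply: eq_card => B; rewrite !inE.
split.
- by rewrite card_ord Zp_cast.
- move=> b; rewrite points_on_set_system.
  by have := valP b; rewrite inE => /balancedP[].
- by move=> S cS; rewrite through //; case: exists_inP => _; [left | right].
(* Here [r = 1] is the exception: [3 * 1 = 0 + 1 + 2]. *)
- have c3 : #|[set 0; 1; 2%:R]%R : {set 'Z_n}| = 3 by apply: card_set01k; lia.
  exists ([set 0; 1; 2%:R]%R : {set 'Z_n}) => //.
  rewrite through // sum_set01k; last by lia.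
  suff -> : [exists r in [set 0; 1; 2%:R], r *+ 3 == 3%:R :> 'Z_n]%R by [].
  by apply/exists_inP; exists 1%R; rewrite ?inE ?eqxx ?orbT.
(* The sum is 4 and the triples [3r] are 0, 3 and 9, at distances 4, 1 and 5 from it, all below [n];
   so no point is exceptional. *)
have c3 : #|[set 0; 1; 3%:R]%R : {set 'Z_n}| = 3 by apply: card_set01k; lia.
exists ([set 0; 1; 3%:R]%R : {set 'Z_n}) => //.
rewrite through // sum_set01k; last by lia.
have natr_neq k m : k < m -> m - k < n -> (m%:R == k%:R :> 'Z_n)%R = false.
  move=> km lt; rewrite -subr_eq0 -natrB ?(ltnW km) //.
  by apply/negbTE/natr_Zp_neq0; rewrite subn_gt0 km.
case: exists_inP => // -[r]; rewrite !inE.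
case/orP => [/orP[]|] /eqP->; rewrite -?mulrnA.
- by rewrite mul0rn eq_sym -(mulr0n 1%R) natr_neq //; lia.
- by rewrite eq_sym natr_neq //; lia.
by rewrite natr_neq //; lia.
Qed.
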